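(* Let $p\ge1$, and consider a left element $L$ and a right element $R$ sharing one vertical interface, each equipped with tensor-product degree preserving SBP operators $\mathsf D_{\xi_s},\mathsf D_{\eta_s}$ ($s\in\{L,R\}$) of degree $p$ (i.e. differentiation of degree $p$ and one-dimensional norm matrices of degree $\ge 2p$), with possibly different nodal distributions. Let the interface carry an intermediate grid with nodes $\bm\eta_\Gamma$ and a symmetric positive definite norm matrix $\mathsf M_{\hat\Gamma}$ of degree $\ge 2p$, and let $\mathsf P_{\xi,L},\mathsf P_{\xi,R}$ be tensor-product projection operators of degree $\ge p$. Let $\tilde\alpha,\tilde\beta_L,\tilde\beta_R\in\mathbb R$, $\mathcal J_L,\mathcal J_R>0$ and $\sigma\ge 0$ be constants, and consider the semi-discretization $$\frac{\mathrm d\bm u_L}{\mathrm dt}+\frac{\tilde\alpha}{\mathcal J_L}\mathsf D_{\xi_L}\bm u_L+\frac{\tilde\beta_L}{\mathcal J_L}\mathsf D_{\eta_L}\bm u_L=\frac1{\mathcal J_L}\mathsf H_L^{-1}\left(\tilde\alpha\,\mathsf E_{\xi_L,N_\xi}\bm u_L-\bm f_L^*\right),$$ $$\frac{\mathrm d\bm u_R}{\mathrm dt}+\frac{\tilde\alpha}{\mathcal J_R}\mathsf D_{\xi_R}\bm u_R+\frac{\tilde\beta_R}{\mathcal J_R}\mathsf D_{\eta_R}\bm u_R=-\frac1{\mathcal J_R}\mathsf H_R^{-1}\left(\tilde\alpha\,\mathsf E_{\xi_R,1}\bm u_R-\bm f_R^*\right),$$ with numerical fluxes $$\bm f_L^*=\tfrac12\left(\tilde\alpha\mathsf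 E_{\xi_L,N_\xi}\bm u_L+\tilde\alpha\mathsf P_{\xi,L}^{\mathrm T}\mathsf M_{\hat\Gamma}\mathsf P_{\xi,R}\bm u_R\right)-\tfrac{\sigma|\tilde\alpha|}2\left(\mathsf P_{\xi,L}^{\mathrm T}\mathsf M_{\hat\Gamma}\mathsf P_{\xi,R}\bm u_R-\mathsf P_{\xi,L}^{\mathrm T}\mathsf M_{\hat\Gamma}\mathsf P_{\xi,L}\bm u_L\right),$$ $$\bm f_R^*=\tfrac12\left(\tilde\alpha\mathsf E_{\xi_R,1}\bm u_R+\tilde\alpha\mathsf P_{\xi,R}^{\mathrm T}\mathsf M_{\hat\Gamma}\mathsf P_{\xi,L}\bm u_L\right)-\tfrac{\sigma|\tilde\alpha|}2\left(\mathsf P_{\xi,R}^{\mathrm T}\mathsf M_{\hat\Gamma}\mathsf P_{\xi,R}\bm u_R-\mathsf P_{\xi,R}^{\mathrm T}\mathsf M_{\hat\Gamma}\mathsf P_{\xi,L}\bm u_L\right).$$ Then the following hold, where for vectors $\bm v_L,\bm v_R$ the terms associated with the element faces other than the shared interface are collected in $$B(\bm v_L,\bm v_R)=\tilde\alpha\,\bm v_L^{\mathrm T}\mathsf E_{\xi_L,1}\bm u_L-\tilde\beta_L\,\bm v_L^{\mathrm T}\mathsf E_{\eta_L}\bm u_L-\tilde\alpha\,\bm v_R^{\mathrm T}\mathsf E_{\xi_R,N_\xi}\bm u_R-\tilde\beta_R\,\bm v_R^{\mathrm T}\mathsf E_{\eta_R}\bm u_R .$$ 1. (Discrete conservation) The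 discrete integral of the solution is constant in time up to the terms from the other faces: $$\mathcal J_L\bm 1_L^{\mathrm T}\mathsf H_L\frac{\mathrm d\bm u_L}{\mathrm dt}+\mathcal J_R\bm 1_R^{\mathrm T}\mathsf H_R\frac{\mathrm d\bm u_R}{\mathrm dt}=B(\bm 1_L,\bm 1_R).$$ 2. (Discrete energy stability) The interface does not produce energy: $$\mathcal J_L\bm u_L^{\mathrm T}\mathsf H_L\frac{\mathrm d\bm u_L}{\mathrm dt}+\mathcal J_R\bm u_R^{\mathrm T}\mathsf H_R\frac{\mathrm d\bm u_R}{\mathrm dt}-\tfrac12B(\bm u_L,\bm u_R)\le 0.$$ 3. (Degree preservation) The interface coupling terms vanish on polynomials of degree up to $p$ in each variable: for all $i,j\in\{0,\dots,p\}$, if $\bm u_L$ and $\bm u_R$ are the nodal values of one and the same function whose trace on the interface is that of the monomial $\xi^i\eta^j$ (i.e. $\bm u_L=\bm\xi_L^i\otimes\bm\eta_L^j$ and the interface values of $\bm u_R$ are $c^i\bm\eta_R^j$, with $c$ the $\xi$-coordinate of the interface in $L$; or symmetrically $\bm u_R=\bm\xi_R^i\otimes\bm\eta_R^j$ and the interface values of $\bm u_L$ are $c^i\bm\eta_L^j$, with $c$ the $\xi$-coordinate of the interface in $R$), then the right-hand sides of both semi-discrete equations are zero.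
   Context: Powers of vectors are componentwise: $\bm v^{r}=[v_1^r,\dots,v_N^r]^{\mathrm T}$, with $\bm v^r=\bm0$ for $r<0$; $\bm 1$ denotes the vector of ones; $\otimes$ is the Kronecker product. One-dimensional SBP operator of degree $p$: given nodes $\bm\xi=[\xi_1,\dots,\xi_N]^{\mathrm T}$ with $\xi_1,\xi_N$ the endpoints of the interval, a matrix $\mathsf D^{(1D)}$ with $\mathsf D^{(1D)}=(\mathsf H^{(1D)})^{-1}\mathsf Q^{(1D)}$, $\mathsf Q^{(1D)}=\mathsf S^{(1D)}+\tfrac12\mathsf E^{(1D)}$, where $\mathsf D^{(1D)}\bm\xi^k=k\bm\xi^{k-1}$ for $k=0,\dots,p$; $\mathsf H^{(1D)}$ (the norm matrix) is diagonal positive definite; $\mathsf S^{(1D)}$ is skew-symmetric; and $\mathsf E^{(1D)}=\bm e_N\bm e_N^{\mathrm T}-\bm e_1\bm e_1^{\mathrm T}$ with $\bm e_1=[1,0,\dots,0]^{\mathrm T}$, $\bm e_N=[0,\dots,0,1]^{\mathrm T}$. A norm matrix is of degree $\tilde p$ if $(\bm\xi^i)^{\mathrm T}\mathsf H^{(1D)}\bm\xi^j=\int_{\xi_1}^{\xi_N}\xi^{i+j}\mathrm d\xi$ for $i,j\in\{0,\dots,p\}$, $i+j\le\tilde p$ (similarly for $\mathsf M_{\hat\Gamma}$ on $\bm\eta_\Gamma$). A degree preserving SBP operator of degree $p$ is an SBP operator of degree $p$ whose norm matrix is of degree at least $2p$. Tensor-product operators: in each element $s\in\{L,R\}$ there are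 one-dimensional nodes $\bm\xi_s$ ($N_\xi$ of them) and $\bm\eta_s$ ($N_\eta$ of them; these numbers may differ between $L$ and $R$) with one-dimensional SBP operators in $\xi$ and $\eta$. Dropping the index $s$: $\mathsf D_\xi=\mathsf D_\xi^{(1D)}\otimes\mathsf I_\eta$, $\mathsf D_\eta=\mathsf I_\xi\otimes\mathsf D_\eta^{(1D)}$, $\mathsf H=\mathsf H_\xi^{(1D)}\otimes\mathsf H_\eta^{(1D)}$; $\mathsf R_{\xi,1}=\bm e_{\xi,1}^{\mathrm T}\otimes\mathsf I_\eta$, $\mathsf R_{\xi,N_\xi}=\bm e_{\xi,N_\xi}^{\mathrm T}\otimes\mathsf I_\eta$, $\mathsf R_{\eta,1}=\mathsf I_\xi\otimes\bm e_{\eta,1}^{\mathrm T}$, $\mathsf R_{\eta,N_\eta}=\mathsf I_\xi\otimes\bm e_{\eta,N_\eta}^{\mathrm T}$; $\mathsf E_{\xi,m}=\mathsf R_{\xi,m}^{\mathrm T}\mathsf H_\eta^{(1D)}\mathsf R_{\xi,m}$ for $m\in\{1,N_\xi\}$, $\mathsf E_{\eta,m}=\mathsf R_{\eta,m}^{\mathrm T}\mathsf H_\xi^{(1D)}\mathsf R_{\eta,m}$ for $m\in\{1,N_\eta\}$, $\mathsf E_\xi=\mathsf E_{\xi,N_\xi}-\mathsf E_{\xi,1}$, $\mathsf E_\eta=\mathsf E_{\eta,N_\eta}-\mathsf E_{\eta,1}$. The interface is the last $\xi$-line of $L$ and the first $\xi$-line of $R$: the interface values are $\mathsf R_{\xi_L,N_\xi}\bm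 u_L$ and $\mathsf R_{\xi_R,1}\bm u_R$; the coordinate $\eta$ along it is common to both elements and to the intermediate grid. Projection operators of degree (at least) $p$: $\mathsf P_{\xi,L}=\bm e_{\xi_L,N_\xi}^{\mathrm T}\otimes\mathsf P_L^{(1D)}$ and $\mathsf P_{\xi,R}=\bm e_{\xi_R,1}^{\mathrm T}\otimes\mathsf P_R^{(1D)}$, where for $s\in\{L,R\}$ and $k=0,1,\dots,p$, $$\mathsf P_s^{(1D)}\bm\eta_s^k=\bm\eta_\Gamma^k,\qquad(\mathsf P_s^{(1D)})^{\mathrm T}\mathsf M_{\hat\Gamma}\bm\eta_\Gamma^k=\mathsf H_{\eta_s}^{(1D)}\bm\eta_s^k .$$ The equations discretize the constant-coefficient linear advection equation in two dimensions on two affinely mapped quadrilateral elements, so metric terms are constants and $\tilde\alpha$ is the same in both elements. $\sigma=0$ gives a central and $\sigma=1$ an upwind coupling. *)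

(* Defs.v *)
From mathcomp Require Import all_boot all_order all_algebra.
From mathcomp Require Import all_classical all_reals all_analysis.
From mathcomp Require Export mxtens.

Set Implicit Arguments.
Unset Strict Implicit.
Unset Printing Implicit Defensive.

Import Order.TTheory GRing.Theory Num.Theory.
Import numFieldNormedType.Exports.

Local Open Scope ring_scope.
Local Open Scope classical_set_scope.

Definition vpow (R : realType) (n : nat) (v : 'cV[R]_n) (r : nat) : 'cV[R]_n :=
  map_mx (fun x => x ^+ r) v.

Definition mxform (R : realType) (m n : nat)
    (u : 'cV[R]_m) (A : 'M[R]_(m, n)) (v : 'cV[R]_n) : R :=
  (u^T *m A *m v) 0 0.

Definition spd (R : realType) (n : nat) (A : 'M[R]_n) : Prop :=
  A^T = A /\ (forall v : 'cV[R]_n, v != 0 -> 0 < mxform v A v).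

Definition basis_col (R : realType) (n : nat) (m : 'I_n) : 'cV[R]_n :=
  delta_mx m 0.

(* An operator on n.+1 nodes: [ord0] and [ord_max] are the first and the last
   index, and the corresponding nodes are the endpoints of the interval.  At
   k = 0 the convention v^(-1) = 0 is subsumed by the factor k = 0. *)
Record sbp_operator (R : realType) (p n : nat) := SbpOperator {
  nodes : 'cV[R]_n.+1;
  normmx : 'M[R]_n.+1;
  skewmx : 'M[R]_n.+1;
  stiffmx : 'M[R]_n.+1;
  diffmx : 'M[R]_n.+1;
  sbp_endpoints : nodes ord0 0 < nodes ord_max 0;
  sbp_nodes : forall i, nodes ord0 0 <= nodes i 0 <= nodes ord_max 0;
  sbp_norm_diag : is_diag_mx normmx;
  sbp_norm_spd : spd normmx;
  sbp_skew : skewmx^T = - skewmx;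
  sbp_stiff : stiffmx = skewmx + 2^-1 *:
    (basis_col R ord_max *m (basis_col R ord_max)^T
     - basis_col R ord0 *m (basis_col R ord0)^T);
  sbp_diff : diffmx = invmx normmx *m stiffmx;
  sbp_exact : forall k, (k <= p)%N ->
    diffmx *m vpow nodes k = k%:R *: vpow nodes k.-1
}.

Definition node_first (R : realType) (p n : nat) (D : sbp_operator R p n) : R :=
  nodes D ord0 0.

Definition node_last (R : realType) (p n : nat) (D : sbp_operator R p n) : R :=
  nodes D ord_max 0.

(* Degree at least q of the norm matrix H at the nodes v in the interval
   [a, b]; the test exponents i, j are at most p. *)
Definition norm_degree (R : realType) (p q : nat) (a b : R) (n : nat)
    (v : 'cV[R]_n) (H : 'M[R]_n) : Prop :=
  forall i j, (i <= p)%N -> (j <= p)%N -> (i + j <= q)%N ->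
    mxform (vpow v i) H (vpow v j) =
    \int[lebesgue_measure]_(x in `[a, b]) (x ^+ (i + j)).

Definition degree_preserving (R : realType) (p n : nat)
    (D : sbp_operator R p n) : Prop :=
  norm_degree p (2 * p) (node_first D) (node_last D) (nodes D) (normmx D).

Record element (R : realType) (p nxi neta : nat) := Element {
  xi_op : sbp_operator R p nxi;
  eta_op : sbp_operator R p neta
}.

(* The casts identify 'I_(1 * m) and 'I_(m * 1) with 'I_m. *)
Definition tens_row_mx (R : realType) (n k l : nat)
    (w : 'rV[R]_n) (A : 'M[R]_(k, l)) : 'M[R]_(k, n * l) :=
  castmx (mul1n k, erefl (n * l)%N) (w *t A).

Definition tens_mx_row (R : realType) (n k l : nat)
    (A : 'M[R]_(k, l)) (w : 'rV[R]_n) : 'M[R]_(k, l * n) :=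
  castmx (muln1 k, erefl (l * n)%N) (A *t w).

Section TensorOperators.

Variables (R : realType) (p nxi neta : nat) (K : element R p nxi neta).

Local Notation N := (nxi.+1 * neta.+1)%N.

Definition D_xi : 'M[R]_N := diffmx (xi_op K) *t 1%:M.
Definition D_eta : 'M[R]_N := 1%:M *t diffmx (eta_op K).
Definition H_elt : 'M[R]_N := normmx (xi_op K) *t normmx (eta_op K).

Definition R_xi (m : 'I_nxi.+1) : 'M[R]_(neta.+1, N) :=
  tens_row_mx (basis_col R m)^T 1%:M.
Definition R_eta (m : 'I_neta.+1) : 'M[R]_(nxi.+1, N) :=
  tens_mx_row 1%:M (basis_col R m)^T.

Definition E_xi_at (m : 'I_nxi.+1) : 'M[R]_N :=
  (R_xi m)^T *m normmx (eta_op K) *m R_xi m.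
Definition E_eta_at (m : 'I_neta.+1) : 'M[R]_N :=
  (R_eta m)^T *m normmx (xi_op K) *m R_eta m.

Definition E_eta : 'M[R]_N := E_eta_at ord_max - E_eta_at ord0.

(* [tensmx] is xi-major: entry (a, b) sits at index a * neta.+1 + b. *)
Definition monomial_at_nodes (i j : nat) : 'cV[R]_N :=
  vpow (nodes (xi_op K)) i *t vpow (nodes (eta_op K)) j.

End TensorOperators.

Definition projection_degree (R : realType) (p n nG : nat)
    (D : sbp_operator R p n) (etaG : 'cV[R]_nG) (M : 'M[R]_nG)
    (P : 'M[R]_(nG, n.+1)) : Prop :=
  forall k, (k <= p)%N ->
    P *m vpow (nodes D) k = vpow etaG k /\
    P^T *m M *m vpow etaG k = normmx D *m vpow (nodes D) k.

Section Coupling.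

Variables (R : realType) (p nxiL netaL nxiR netaR nG : nat).
Variables (eL : element R p nxiL netaL) (eR : element R p nxiR netaR).
Variables (M : 'M[R]_nG) (PL : 'M[R]_(nG, netaL.+1)) (PR : 'M[R]_(nG, netaR.+1)).
Variables (alpha betaL betaR JL JR sigma : R).

Local Notation NL := (nxiL.+1 * netaL.+1)%N.
Local Notation NR := (nxiR.+1 * netaR.+1)%N.

Definition P_xiL : 'M[R]_(nG, NL) := tens_row_mx (basis_col R ord_max)^T PL.
Definition P_xiR : 'M[R]_(nG, NR) := tens_row_mx (basis_col R ord0)^T PR.

Definition fluxL (uL : 'cV[R]_NL) (uR : 'cV[R]_NR) : 'cV[R]_NL :=
  2^-1 *: (alpha *: (E_xi_at eL ord_max *m uL)
           + alpha *: (P_xiL^T *m M *m P_xiR *m uR))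
  - (sigma * `|alpha| / 2) *:
      (P_xiL^T *m M *m P_xiR *m uR - P_xiL^T *m M *m P_xiL *m uL).

Definition fluxR (uL : 'cV[R]_NL) (uR : 'cV[R]_NR) : 'cV[R]_NR :=
  2^-1 *: (alpha *: (E_xi_at eR ord0 *m uR)
           + alpha *: (P_xiR^T *m M *m P_xiL *m uL))
  - (sigma * `|alpha| / 2) *:
      (P_xiR^T *m M *m P_xiR *m uR - P_xiR^T *m M *m P_xiL *m uL).

Definition rhsL (uL : 'cV[R]_NL) (uR : 'cV[R]_NR) : 'cV[R]_NL :=
  JL^-1 *: (invmx (H_elt eL) *m
    (alpha *: (E_xi_at eL ord_max *m uL) - fluxL uL uR)).

Definition rhsR (uL : 'cV[R]_NL) (uR : 'cV[R]_NR) : 'cV[R]_NR :=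
  - (JR^-1 *: (invmx (H_elt eR) *m
      (alpha *: (E_xi_at eR ord0 *m uR) - fluxR uL uR))).

(* The two equations at one instant t, the solution being differentiable there. *)
Definition semi_discretization
    (uL : R -> 'cV[R]_NL) (uR : R -> 'cV[R]_NR) (t : R) : Prop :=
  [/\ derivable uL t 1, derivable uR t 1,
      derive1 uL t + (alpha / JL) *: (D_xi eL *m uL t)
        + (betaL / JL) *: (D_eta eL *m uL t) = rhsL (uL t) (uR t) &
      derive1 uR t + (alpha / JR) *: (D_xi eR *m uR t)
        + (betaR / JR) *: (D_eta eR *m uR t) = rhsR (uL t) (uR t)].

Definition face_terms (vL uL : 'cV[R]_NL) (vR uR : 'cV[R]_NR) : R :=
  alpha * mxform vL (E_xi_at eL ord0) uL - betaL * mxform vL (E_eta eL) uL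
  - alpha * mxform vR (E_xi_at eR ord_max) uR
  - betaR * mxform vR (E_eta eR) uR.

End Coupling.

(* Main.v *)
Require Import Defs.
From mathcomp Require Import all_boot all_order all_algebra.
From mathcomp Require Import all_classical all_reals all_analysis.
From mathcomp Require Import ring lra.

Set Implicit Arguments.
Unset Strict Implicit.
Unset Printing Implicit Defensive.

Import Order.TTheory GRing.Theory Num.Theory.
Import numFieldNormedType.Exports.

Local Open Scope ring_scope.
Local Open Scope classical_set_scope.

(** In two dimensions, summation by parts reads [A + A^T = E] for [A = H D],
    where [E] gathers the two opposite faces, and [A] annihilates constants.
    Hence the volume terms tested with [u] (resp. with 1) reduce to half (resp.
    all) of the face terms.  At the interface everything factors through the
    traces [a] and [b] of [uL] and [uR]: the central coupling terms cancel in
    the energy and the penalty leaves [- s (PL a - PR b)^T M (PL a - PR b)];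
    tested with 1, or applied to traces of a common polynomial, the coupling
    terms are evaluated by the exactness of [P] and of its [M]-adjoint. *)

(** * Bilinear forms of matrices and definiteness *)

Section BilinearForm.
Variable R : realType.

Lemma mxformDr m n (u : 'cV[R]_m) (A : 'M[R]_(m, n)) v w :
  mxform u A (v + w) = mxform u A v + mxform u A w.
Proof. by rewrite /mxform mulmxDr mxE. Qed.

Lemma mxformDl m n (u v : 'cV[R]_m) (A : 'M[R]_(m, n)) w :
  mxform (u + v) A w = mxform u A w + mxform v A w.
Proof. by rewrite /mxform linearD /= !mulmxDl mxE. Qed.

Lemma mxformDm m n (u : 'cV[R]_m) (A B : 'M[R]_(m, n)) v :
  mxform u (A + B) v = mxform u A v + mxform u B v.
Proof. by rewrite /mxform mulmxDr mulmxDl mxE. Qed.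

Lemma mxformNm m n (u : 'cV[R]_m) (A : 'M[R]_(m, n)) v :
  mxform u (- A) v = - mxform u A v.
Proof. by rewrite /mxform mulmxN mulNmx mxE. Qed.

Lemma mxformZr m n (u : 'cV[R]_m) (A : 'M[R]_(m, n)) a v :
  mxform u A (a *: v) = a * mxform u A v.
Proof. by rewrite /mxform -scalemxAr mxE. Qed.

Lemma mxformNr m n (u : 'cV[R]_m) (A : 'M[R]_(m, n)) v :
  mxform u A (- v) = - mxform u A v.
Proof. by rewrite -scaleN1r mxformZr mulN1r. Qed.

Lemma mxformNl m n (u : 'cV[R]_m) (A : 'M[R]_(m, n)) v :
  mxform (- u) A v = - mxform u A v.
Proof. by rewrite /mxform linearN /= !mulNmx mxE. Qed.

Lemma mxform0r m n (u : 'cV[R]_m) (A : 'M[R]_(m, n)) : mxform u A 0 = 0.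
Proof. by rewrite /mxform mulmx0 mxE. Qed.

Lemma mxform_mulr m n k (u : 'cV[R]_m) (A : 'M[R]_(m, n)) (B : 'M[R]_(n, k)) v :
  mxform u A (B *m v) = mxform u (A *m B) v.
Proof. by rewrite /mxform !mulmxA. Qed.

Lemma mxform_mull m n k (u : 'cV[R]_k) (A : 'M[R]_(m, n)) (B : 'M[R]_(m, k)) v :
  mxform (B *m u) A v = mxform u (B^T *m A) v.
Proof. by rewrite /mxform trmx_mul !mulmxA. Qed.

Lemma mxform_tr m n (u : 'cV[R]_m) (A : 'M[R]_(m, n)) v :
  mxform u A v = mxform v A^T u.
Proof.
rewrite /mxform; have -> : v^T *m A^T *m u = (u^T *m A *m v)^T.
  by rewrite !trmx_mul trmxK mulmxA.
by rewrite [RHS]mxE.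
Qed.

Lemma spd_ge0 n (A : 'M[R]_n) v : spd A -> 0 <= mxform v A v.
Proof.
move=> [_ Apos]; have [->|v0] := eqVneq v 0; first by rewrite mxform0r.
exact/ltW/Apos.
Qed.

(** A nonzero row of the left kernel of [A], once transposed, would be a nonzero vector on which the
    quadratic form vanishes. *)
Lemma spd_unit n (A : 'M[R]_n) : spd A -> A \in unitmx.
Proof.
move=> [As Apos]; rewrite -row_free_unit -kermx_eq0.
apply/eqP/row_matrixP => i; rewrite row0; apply/eqP/negPn/negP => ri0.
have /Apos : (row i (kermx A))^T != 0.
  by apply: contraNneq ri0 => h; rewrite -[row _ _]trmxK h trmx0.
by rewrite /mxform trmxK -row_mul mulmx_ker row0 mul0mx mxE ltxx.
Qed.

End BilinearForm.

(** * Kronecker products with a row vector: traces on grid lines *)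

Section TensorRows.
Variable R : realType.

Lemma castmx_gram m m' n (e : m = m') (A : 'M[R]_(m, n)) (B : 'M[R]_m') :
  (castmx (e, erefl n) A)^T *m B *m castmx (e, erefl n) A =
  A^T *m castmx (esym e, esym e) B *m A.
Proof. by case: m' / e B. Qed.

Lemma castmx_mulr m m' n k (e : m = m') (A : 'M[R]_(m, n)) (B : 'M[R]_(n, k)) :
  castmx (e, erefl n) A *m B = castmx (e, erefl k) (A *m B).
Proof. by case: m' / e. Qed.

Lemma mulmx_castl k k' m m' n (e : m = m') (e' : k = k')
    (A : 'M[R]_(k', m')) (B : 'M[R]_(m, n)) :
  A *m castmx (e, erefl n) B =
  castmx (e', erefl n) (castmx (esym e', esym e) A *m B).
Proof. by case: m' / e A; case: k' / e'. Qed.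

Lemma tens_row_mx_gram n k (w : 'rV[R]_n) (B : 'M[R]_k) :
  (tens_row_mx w 1%:M)^T *m B *m tens_row_mx w 1%:M = (w^T *m w) *t B.
Proof.
by rewrite castmx_gram -tens_scalar1mx trmx_tens !tensmx_mul trmx1 mul1mx !mulmx1.
Qed.

Lemma tens_mx_row_gram n k (w : 'rV[R]_n) (B : 'M[R]_k) :
  (tens_mx_row 1%:M w)^T *m B *m tens_mx_row 1%:M w = B *t (w^T *m w).
Proof.
(* The factor 1 is inserted so that the cast of [1 *: B] folds into [B *t 1%:M], to which the
   mixed-product rule applies. *)
rewrite castmx_gram -[B in castmx _ B]scale1r -tens_mx_scalar trmx_tens.
by rewrite !tensmx_mul trmx1 mul1mx !mulmx1.
Qed.

(** Up to casts [A] is [1%:M *t A], so the mixed-product rule applies. With [w] a basis row, this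
    factors a two-dimensional projection as the trace followed by the one-dimensional projection. *)
Lemma tens_row_mxE n k l (w : 'rV[R]_n) (A : 'M[R]_(k, l)) :
  tens_row_mx w A = A *m tens_row_mx w 1%:M.
Proof.
rewrite [RHS](mulmx_castl _ (mul1n k)) -tens_scalar1mx tensmx_mul mulmx1.
by rewrite mul1mx.
Qed.

Lemma tens_row_mx1_mul n k (w : 'rV[R]_n) (x : 'cV[R]_n) (y : 'cV[R]_k) :
  tens_row_mx w 1%:M *m (x *t y) = (w *m x) 0 0 *: y.
Proof.
rewrite castmx_mulr tensmx_mul mul1mx {1}[w *m x]mx11_scalar tens_scalar_mx.
by rewrite castmx_comp /= castmx_id.
Qed.

Lemma R_xi_tens nxi neta (m : 'I_nxi.+1) (x : 'cV[R]_nxi.+1) (y : 'cV[R]_neta.+1) :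
  R_xi R neta m *m (x *t y) = x m 0 *: y.
Proof.
rewrite /R_xi tens_row_mx1_mul; congr (_ *: _).
by rewrite trmx_delta -rowE mxE.
Qed.

Lemma const_mx1_tens m n :
  (const_mx 1 : 'cV[R]_m) *t (const_mx 1 : 'cV[R]_n) = const_mx 1.
Proof. by apply/matrixP => i j; rewrite !mxE mulr1. Qed.

Lemma R_xi_const1 nxi neta (m : 'I_nxi.+1) :
  R_xi R neta m *m (const_mx 1 : 'cV[R]_(nxi.+1 * neta.+1)) = const_mx 1.
Proof. by rewrite -const_mx1_tens R_xi_tens mxE scale1r. Qed.

Lemma tensmxDl m n k l (A B : 'M[R]_(m, n)) (C : 'M[R]_(k, l)) :
  (A + B) *t C = A *t C + B *t C.
Proof. by apply/matrixP => i j; rewrite !mxE mulrDl. Qed.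

Lemma tensmxDr m n k l (A : 'M[R]_(m, n)) (B C : 'M[R]_(k, l)) :
  A *t (B + C) = A *t B + A *t C.
Proof. by apply/matrixP => i j; rewrite !mxE mulrDr. Qed.

Lemma tensmxNl m n k l (A : 'M[R]_(m, n)) (C : 'M[R]_(k, l)) :
  (- A) *t C = - (A *t C).
Proof. by apply/matrixP => i j; rewrite !mxE mulNr. Qed.

Lemma tensmxNr m n k l (A : 'M[R]_(m, n)) (C : 'M[R]_(k, l)) :
  A *t (- C) = - (A *t C).
Proof. by apply/matrixP => i j; rewrite !mxE mulrN. Qed.

End TensorRows.

(** * Summation by parts, from one dimension to the element *)

Section SummationByParts.
Variables (R : realType) (p : nat).

Lemma vpow0 n (v : 'cV[R]_n) : vpow v 0 = const_mx 1.
Proof. by apply/matrixP => i j; rewrite !mxE expr0. Qed.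

Lemma sbp_norm_unit n (D : sbp_operator R p n) : Defs.normmx D \in unitmx.
Proof. exact: spd_unit (sbp_norm_spd D). Qed.

Lemma normmx_diffmx n (D : sbp_operator R p n) :
  Defs.normmx D *m Defs.diffmx D = stiffmx D.
Proof. by rewrite sbp_diff mulKVmx ?sbp_norm_unit. Qed.

(** This is exactness of the derivative at degree 0, multiplied by the norm matrix. *)
Lemma stiffmx_const1 n (D : sbp_operator R p n) : stiffmx D *m (const_mx 1 : 'cV[R]_n.+1) = 0.
Proof.
by rewrite -normmx_diffmx -(vpow0 (nodes D)) -mulmxA sbp_exact // scale0r mulmx0.
Qed.

(** The skew part cancels against its transpose, and the symmetric boundary part, weighted by one
    half, is counted twice. *)
Lemma stiffmxD_tr n (D : sbp_operator R p n) :
  stiffmx D + (stiffmx D)^T =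
  basis_col R ord_max *m (basis_col R ord_max)^T
  - basis_col R ord0 *m (basis_col R ord0)^T.
Proof.
rewrite sbp_stiff; set B := _ - _.
have Bt : B^T = B by rewrite /B linearB /= !trmx_mul !trmxK.
rewrite [(_ + _)^T]linearD /= [(_ *: _)^T]linearZ /= Bt sbp_skew addrACA subrr add0r -scalerDl.
by rewrite (_ : 2^-1 + 2^-1 = 1 :> R) ?scale1r //; field.
Qed.

Variables (nxi neta : nat) (K : element R p nxi neta).

(** Counterpart of [E_eta]. In the equations and in [face_terms] the two faces appear separately,
    since one of them is the interface. *)
Definition E_xi := E_xi_at K ord_max - E_xi_at K ord0.

Lemma E_xi_atE m : E_xi_at K m =
  (basis_col R m *m (basis_col R m)^T) *t Defs.normmx (eta_op K).
Proof. by rewrite /E_xi_at /R_xi tens_row_mx_gram trmxK. Qed.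

Lemma E_eta_atE m : E_eta_at K m =
  Defs.normmx (xi_op K) *t (basis_col R m *m (basis_col R m)^T).
Proof. by rewrite /E_eta_at /R_eta tens_mx_row_gram trmxK. Qed.

Lemma H_elt_D_xi : H_elt K *m D_xi K = stiffmx (xi_op K) *t Defs.normmx (eta_op K).
Proof. by rewrite /H_elt /D_xi tensmx_mul mulmx1 normmx_diffmx. Qed.

Lemma H_elt_D_eta : H_elt K *m D_eta K = Defs.normmx (xi_op K) *t stiffmx (eta_op K).
Proof. by rewrite /H_elt /D_eta tensmx_mul mulmx1 normmx_diffmx. Qed.

(** The one-dimensional identity in the first variable, tensored with the symmetric norm matrix of
    the second. *)
Lemma sbp_xi : H_elt K *m D_xi K + (H_elt K *m D_xi K)^T = E_xi.
Proof.
rewrite H_elt_D_xi trmx_tens (sbp_norm_spd (eta_op K)).1 -tensmxDl stiffmxD_tr.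
by rewrite tensmxDl tensmxNl /E_xi !E_xi_atE.
Qed.

Lemma sbp_eta : H_elt K *m D_eta K + (H_elt K *m D_eta K)^T = E_eta K.
Proof.
rewrite H_elt_D_eta trmx_tens (sbp_norm_spd (xi_op K)).1 -tensmxDr stiffmxD_tr.
by rewrite tensmxDr tensmxNr /E_eta !E_eta_atE.
Qed.

Lemma H_elt_D_xi_const1 : H_elt K *m D_xi K *m (const_mx 1 : 'cV[R]_(nxi.+1 * neta.+1)) = 0.
Proof.
rewrite H_elt_D_xi; have := tensmx_mul (stiffmx (xi_op K)) (Defs.normmx (eta_op K))
  (const_mx 1 : 'cV[R]_nxi.+1) (const_mx 1 : 'cV[R]_neta.+1).
by rewrite const_mx1_tens stiffmx_const1 tens0mx.
Qed.

Lemma H_elt_D_eta_const1 : H_elt K *m D_eta K *m (const_mx 1 : 'cV[R]_(nxi.+1 * neta.+1)) = 0.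
Proof.
rewrite H_elt_D_eta; have := tensmx_mul (Defs.normmx (xi_op K)) (stiffmx (eta_op K))
  (const_mx 1 : 'cV[R]_nxi.+1) (const_mx 1 : 'cV[R]_neta.+1).
by rewrite const_mx1_tens stiffmx_const1 tensmx0.
Qed.

Lemma H_elt_unit : H_elt K \in unitmx.
Proof. by rewrite tensmx_unit ?sbp_norm_unit. Qed.

Lemma mxform_sbp_energy n (A E : 'M[R]_n) u :
  A + A^T = E -> mxform u A u = 2^-1 * mxform u E u.
Proof. by move=> <-; rewrite mxformDm -[mxform u A^T u]mxform_tr; field. Qed.

(** The extra term is the form of [A^T] at [v] and [u], that is, of [A] at [u] and [v], which
    vanishes. *)
Lemma mxform_sbp_const n (A E : 'M[R]_n) v u :
  A + A^T = E -> A *m v = 0 -> mxform v A u = mxform v E u.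
Proof.
move=> <- Av0; rewrite mxformDm -[mxform v A^T u]mxform_tr.
by rewrite {3}/mxform -mulmxA Av0 mulmx0 mxE addr0.
Qed.

(** Testing with [v] in the norm [H_elt K] cancels both inverses. The bracket [g] is arbitrary, so
    the lemma serves both elements. *)
Lemma weak_form (J a b : R) (u' u g v : 'cV[R]_(nxi.+1 * neta.+1)) : 0 < J ->
  u' + (a / J) *: (D_xi K *m u) + (b / J) *: (D_eta K *m u)
    = J^-1 *: (invmx (H_elt K) *m g) ->
  J * mxform v (H_elt K) u' = mxform v 1%:M g
    - a * mxform v (H_elt K *m D_xi K) u - b * mxform v (H_elt K *m D_eta K) u.
Proof.
move=> J0 /(congr1 (mxform v (H_elt K))).
rewrite !mxformDr !mxformZr !mxform_mulr mulmxV ?H_elt_unit // => h.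
have -> : mxform v 1%:M g = J * (J^-1 * mxform v 1%:M g).
  by rewrite mulVKf // gt_eqF.
by rewrite -h; field; rewrite gt_eqF.
Qed.

End SummationByParts.

(** * Numerical fluxes expressed through interface traces *)

Section InterfaceFlux.
Variable R : realType.

(** The numerical flux on the interface line, with [a] the trace of the element itself and [b] that
    of its neighbour. The penalty coefficient [s] may have either sign, so one formula covers both
    sides. *)
Definition face_flux n n' nG (H : 'M[R]_n) (P : 'M[R]_(nG, n)) (P' : 'M[R]_(nG, n'))
    (M : 'M[R]_nG) (alpha s : R) (a : 'cV[R]_n) (b : 'cV[R]_n') : 'cV[R]_n :=
  (alpha / 2) *: (H *m a + P^T *m M *m (P' *m b))
  - s *: (P^T *m M *m (P' *m b - P *m a)).

Variables (p nxiL netaL nxiR netaR nG : nat).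
Variables (eL : element R p nxiL netaL) (eR : element R p nxiR netaR).
Variables (M : 'M[R]_nG) (PL : 'M[R]_(nG, netaL.+1)) (PR : 'M[R]_(nG, netaR.+1)).
Variables (alpha sigma : R).

Lemma fluxLE uL uR : fluxL eL M PL PR alpha sigma uL uR =
  (R_xi R netaL ord_max)^T *m
  face_flux (Defs.normmx (eta_op eL)) PL PR M alpha (sigma * `|alpha| / 2)
    (R_xi R netaL ord_max *m uL) (R_xi R netaR (ord0 : 'I_nxiR.+1) *m uR).
Proof.
rewrite /fluxL /face_flux /E_xi_at /P_xiL /P_xiR (tens_row_mxE _ PL).
rewrite (tens_row_mxE _ PR) -/(R_xi R netaL _) -/(R_xi R netaR _) !trmx_mul.
rewrite -scalerDr scalerA [2^-1 * _]mulrC.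
by rewrite !(mulmxDr, mulmxN, =^~ scalemxAr, scalerDr, mulmxA).
Qed.

(* Compared with the flux of the left element, the penalty has the opposite
   sign, as the outward normals are opposite. *)
Lemma fluxRE uL uR : fluxR eR M PL PR alpha sigma uL uR =
  (R_xi R netaR ord0)^T *m
  face_flux (Defs.normmx (eta_op eR)) PR PL M alpha (- (sigma * `|alpha| / 2))
    (R_xi R netaR ord0 *m uR) (R_xi R netaL (ord_max : 'I_nxiL.+1) *m uL).
Proof.
rewrite /fluxR /face_flux /E_xi_at /P_xiL /P_xiR (tens_row_mxE _ PL).
rewrite (tens_row_mxE _ PR) -/(R_xi R netaL _) -/(R_xi R netaR _) !trmx_mul.
(* [opprB] turns the own-minus-neighbour difference of [fluxR] into the neighbour-minus-own order of
   [face_flux]. *)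
rewrite -scalerDr scalerA [2^-1 * _]mulrC scaleNr -[X in _ - _ *: X = _]opprB scalerN.
by rewrite !(mulmxDr, mulmxN, =^~ scalemxAr, scalerDr, mulmxA).
Qed.

Lemma mxform_E_xi_at nxi neta (K : element R p nxi neta) m u v :
  mxform u (E_xi_at K m) v =
  mxform (R_xi R neta m *m u) (Defs.normmx (eta_op K)) (R_xi R neta m *m v).
Proof. by rewrite mxform_mulr mxform_mull mulmxA. Qed.

End InterfaceFlux.

Lemma mxform_face_flux (R : realType) n n' nG (H : 'M[R]_n) (P : 'M[R]_(nG, n))
    (P' : 'M[R]_(nG, n')) (M : 'M[R]_nG) (alpha s : R) v a b :
  mxform v 1%:M (face_flux H P P' M alpha s a b) =
  (alpha / 2) * (mxform v H a + mxform (P *m v) M (P' *m b))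
  - s * (mxform (P *m v) M (P' *m b) - mxform (P *m v) M (P *m a)).
Proof.
rewrite /face_flux !(mxformDr, mxformNr, mxformZr, mulmxDr, mulmxN).
by rewrite !mxform_mull !mxform_mulr !mul1mx.
Qed.

(** [P] maps ones to ones, and adjoint exactness at degree 0 then turns integrals over the
    intermediate grid into integrals over each side. The result is unchanged when the sides are
    swapped and [s] is negated, which is conservation at the interface. *)
Lemma mxform_one_face_flux (R : realType) p n n' nG (D : sbp_operator R p n)
    (D' : sbp_operator R p n') etaG (M : 'M[R]_nG) P P' (alpha s : R) a b :
  spd M -> projection_degree D etaG M P -> projection_degree D' etaG M P' ->
  mxform (const_mx 1) 1%:M (face_flux (Defs.normmx D) P P' M alpha s a b) =
  (alpha / 2 + s) * mxform (const_mx 1) (Defs.normmx D) a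
  + (alpha / 2 - s) * mxform (const_mx 1) (Defs.normmx D') b.
Proof.
move=> [Ms _] /(_ 0 (leq0n p)); rewrite !vpow0 => -[P1 PM1].
move=> /(_ 0 (leq0n p)); rewrite !vpow0 => -[_ P'M1].
have one n1 (D1 : sbp_operator R p n1) P1' c :
  P1'^T *m M *m (const_mx 1 : 'cV[R]_nG) = Defs.normmx D1 *m const_mx 1 ->
  mxform (const_mx 1) M (P1' *m c) = mxform (const_mx 1) (Defs.normmx D1) c.
  move=> h; rewrite mxform_mulr mxform_tr trmx_mul Ms [RHS]mxform_tr.
  by rewrite (sbp_norm_spd D1).1 /mxform -!mulmxA -h !mulmxA.
rewrite mxform_face_flux P1 (one _ _ _ _ PM1) (one _ _ _ _ P'M1).
by ring.
Qed.

(** Both traces project to the same vector, so the penalty vanishes; adjoint exactness makes the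
    neighbour's half of the average equal to the element's own half. *)
Lemma face_flux_consistent (R : realType) p n n' nG (D : sbp_operator R p n)
    (D' : sbp_operator R p n') etaG (M : 'M[R]_nG) P P' (alpha s c : R) j :
  projection_degree D etaG M P -> projection_degree D' etaG M P' -> (j <= p)%N ->
  face_flux (Defs.normmx D) P P' M alpha s (c *: vpow (nodes D) j)
    (c *: vpow (nodes D') j) =
  alpha *: (Defs.normmx D *m (c *: vpow (nodes D) j)).
Proof.
move=> hP hP' jp; have [Pj PMj] := hP j jp; have [P'j _] := hP' j jp.
rewrite /face_flux -!scalemxAr Pj P'j subrr mulmx0 scaler0 subr0 PMj.
by rewrite -scalerDr -mulr2n -[(_ *m _) *+ 2]scaler_nat !scalerA; congr (_ *: _); field.
Qed.

Theorem theorem3 (R : realType) (p nxiL netaL nxiR netaR nG : nat)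
    (eL : element R p nxiL netaL) (eR : element R p nxiR netaR)
    (etaG : 'cV[R]_nG) (M : 'M[R]_nG)
    (PL : 'M[R]_(nG, netaL.+1)) (PR : 'M[R]_(nG, netaR.+1))
    (alpha betaL betaR JL JR sigma : R)
    (hp : (1 <= p)%N)
    (hxiL : degree_preserving (xi_op eL)) (hetaL : degree_preserving (eta_op eL))
    (hxiR : degree_preserving (xi_op eR)) (hetaR : degree_preserving (eta_op eR))
    (hfirst : node_first (eta_op eL) = node_first (eta_op eR))
    (hlast : node_last (eta_op eL) = node_last (eta_op eR))
    (hG : forall i, node_first (eta_op eL) <= etaG i 0 <= node_last (eta_op eL))
    (hM : spd M)
    (hMdeg : norm_degree p (2 * p)
       (node_first (eta_op eL)) (node_last (eta_op eL)) etaG M)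
    (hPL : projection_degree (eta_op eL) etaG M PL)
    (hPR : projection_degree (eta_op eR) etaG M PR)
    (hJL : 0 < JL) (hJR : 0 < JR) (hsigma : 0 <= sigma) :
  [/\ forall (uL : R -> 'cV[R]_(nxiL.+1 * netaL.+1))
             (uR : R -> 'cV[R]_(nxiR.+1 * netaR.+1)) (t : R),
        semi_discretization eL eR M PL PR alpha betaL betaR JL JR sigma uL uR t ->
        JL * mxform (const_mx 1) (H_elt eL) (derive1 uL t)
          + JR * mxform (const_mx 1) (H_elt eR) (derive1 uR t)
        = face_terms eL eR alpha betaL betaR
            (const_mx 1) (uL t) (const_mx 1) (uR t),
      forall (uL : R -> 'cV[R]_(nxiL.+1 * netaL.+1))
             (uR : R -> 'cV[R]_(nxiR.+1 * netaR.+1)) (t : R),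
        semi_discretization eL eR M PL PR alpha betaL betaR JL JR sigma uL uR t ->
        JL * mxform (uL t) (H_elt eL) (derive1 uL t)
          + JR * mxform (uR t) (H_elt eR) (derive1 uR t)
        - 2^-1 * face_terms eL eR alpha betaL betaR (uL t) (uL t) (uR t) (uR t)
        <= 0 &
      forall (i j : nat) (uL : 'cV[R]_(nxiL.+1 * netaL.+1))
             (uR : 'cV[R]_(nxiR.+1 * netaR.+1)),
        (i <= p)%N -> (j <= p)%N ->
        (uL = monomial_at_nodes eL i j /\
         R_xi R netaR ord0 *m uR
           = node_last (xi_op eL) ^+ i *: vpow (nodes (eta_op eR)) j)
        \/
        (uR = monomial_at_nodes eR i j /\
         R_xi R netaL ord_max *m uL
           = node_first (xi_op eR) ^+ i *: vpow (nodes (eta_op eL)) j) ->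
        rhsL eL M PL PR alpha JL sigma uL uR = 0 /\
        rhsR eR M PL PR alpha JR sigma uL uR = 0].
Proof.
set rL := R_xi R netaL (ord_max : 'I_nxiL.+1).
set rR := R_xi R netaR (ord0 : 'I_nxiR.+1).
set s := sigma * `|alpha| / 2.
have weakL uL uR t v :
    semi_discretization eL eR M PL PR alpha betaL betaR JL JR sigma uL uR t ->
    JL * mxform v (H_elt eL) (derive1 uL t) =
    alpha * mxform v (E_xi_at eL ord_max) (uL t)
    - mxform (rL *m v) 1%:M (face_flux (Defs.normmx (eta_op eL)) PL PR M alpha s
        (rL *m uL t) (rR *m uR t))
    - alpha * mxform v (H_elt eL *m D_xi eL) (uL t)
    - betaL * mxform v (H_elt eL *m D_eta eL) (uL t).
  case=> _ _ eqL _; rewrite (weak_form v hJL eqL) fluxLE -/rL -/rR -/s.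
  rewrite mxformDr mxformNr mxformZr [mxform _ _ (rL^T *m _)]mxform_mulr.
  by rewrite [mxform _ _ (E_xi_at _ _ *m _)]mxform_mulr mxform_mull mulmx1 !mul1mx.
have weakR uL uR t v :
    semi_discretization eL eR M PL PR alpha betaL betaR JL JR sigma uL uR t ->
    JR * mxform v (H_elt eR) (derive1 uR t) =
    - alpha * mxform v (E_xi_at eR ord0) (uR t)
    + mxform (rR *m v) 1%:M (face_flux (Defs.normmx (eta_op eR)) PR PL M alpha (- s)
        (rR *m uR t) (rL *m uL t))
    - alpha * mxform v (H_elt eR *m D_xi eR) (uR t)
    - betaR * mxform v (H_elt eR *m D_eta eR) (uR t).
  (* The sign in front of the right-hand side moves into the bracket, to match [weak_form]. *)
  case=> _ _ _; rewrite /rhsR -scalerN -mulmxN => eqR.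
  rewrite (weak_form v hJR eqR) fluxRE -/rL -/rR -/s.
  rewrite mxformNr mxformDr mxformNr mxformZr [mxform _ _ (rR^T *m _)]mxform_mulr.
  rewrite [mxform _ _ (E_xi_at _ _ *m _)]mxform_mulr mxform_mull mulmx1 !mul1mx.
  by ring.
split.
- move=> uL uR t sd; rewrite (weakL _ _ _ _ sd) (weakR _ _ _ _ sd).
  rewrite !(mxform_sbp_const _ (sbp_xi _) (H_elt_D_xi_const1 _)).
  rewrite !(mxform_sbp_const _ (sbp_eta _) (H_elt_D_eta_const1 _)).
  (* The two fluxes, with [s] and [- s], have the same discrete integral, so they cancel in the
     sum. *)
  rewrite /rL /rR !R_xi_const1 (mxform_one_face_flux _ _ _ _ hM hPL hPR).
  rewrite (mxform_one_face_flux _ _ _ _ hM hPR hPL) /face_terms.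
  by rewrite /E_xi !mxformDm !mxformNm; ring.
- move=> uL uR t sd; rewrite (weakL _ _ _ _ sd) (weakR _ _ _ _ sd).
  rewrite !(mxform_sbp_energy _ (sbp_xi _)) !(mxform_sbp_energy _ (sbp_eta _)).
  rewrite !mxform_face_flux /face_terms /E_xi !mxformDm !mxformNm.
  rewrite !mxform_E_xi_at -/rL -/rR.
  set x := PL *m _; set y := PR *m _.
  have s0 : 0 <= s by rewrite divr_ge0 ?mulr_ge0.
  (* The penalty dissipates exactly this quantity; it is expanded so that the goal becomes linear in
     the forms. *)
  have := mulr_ge0 s0 (spd_ge0 (x - y) hM).
  rewrite !(mxformDl, mxformDr, mxformNl, mxformNr).
  (* Symmetry of [M] identifies the cross terms, so the central couplings of the two sides
     cancel. *)
  rewrite (_ : mxform y M x = mxform x M y); last by rewrite mxform_tr hM.1.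
  by lra.
move=> i j uL uR ip jp traces.
(* Both alternatives reduce to this: [c] is the [i]-th power of the interface coordinate in the
   element carrying the monomial. *)
have [c [aE bE]] : exists c, rL *m uL = c *: vpow (nodes (eta_op eL)) j /\
    rR *m uR = c *: vpow (nodes (eta_op eR)) j.
  case: traces => -[-> e]; [exists (node_last (xi_op eL) ^+ i)
                           |exists (node_first (xi_op eR) ^+ i)];
    by rewrite e R_xi_tens mxE.
rewrite /rhsL /rhsR fluxLE fluxRE -/rL -/rR aE bE.
rewrite (face_flux_consistent _ _ _ hPL hPR jp).
rewrite (face_flux_consistent _ _ _ hPR hPL jp) -aE -bE.
by rewrite -!scalemxAr !mulmxA !subrr !mulmx0 !scaler0 oppr0.
Qed.
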